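(* Let $T=\{T_1,\dots,T_n\}$ be a finite set of transactions in the reactor model and let $H$ be a history over $T$ in the reactor model. Then $H$ is serializable in the reactor model if and only if its projection $H'=P(H)$ in the classic transactional model is serializable (in the classic transactional model). Here serializability means conflict-serializability in both models.
   Context: All partial orders are strict (irreflexive and transitive). Saying that an order ''is extended by'' a relation means that it contains that relation. Each of the projected orders $<_S^{i,j}$, $<_T^i$ and $<_{P_H}$ is the smallest transitive relation satisfying the conditions listed for it. **Classic transactional model** (Bernstein, Hadzilacos, Goodman). The database is a set of named data items. The operations of transaction $i$ are reads $r_i[x]$, writes $w_i[x]$, a commit $c_i$ and an abort $a_i$. Two operations conflict iff at least one of them is a write and both of them reference the same named data item. A transaction $T_i$ is a finite partial order with relation $<_i$ such that: it consists of reads, writes, and exactly one of $c_i,a_i$; the commit or abort comes after all other operations; if $r_i[x],w_i[x]\in T_i$ then $r_i[x]<_i w_i[x]$ or $w_i[x]<_i r_i[x]$. A transaction contains at most one read and at most one write of any given data item. **Histories and serializability** (the same in both models; only the meaning of ''operation'' and ''conflict'' changes). - A history over transactions $\{T_1,\dots,T_n\}$ is a partial order with relation $<_H$ such that $H=\bigcup_i T_i$, $<_H\supseteq\bigcup_i <_i$, and any two distinct conflicting operations $p,q\in H$ satisfy $p<_H q$ or $q<_H p$. - A history is serial if for any two distinct transactions in it, all operations of one precede all operations of the other. - Two histories are equivalent if they are over the same set of transactions with the same operations and they order every pair of conflicting operations of non-aborted transactions in the same way. - The committed projection $C(H)$ is the restriction of $H$ to the operations of those transactions $T_i$ with $c_i\in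 T_i$. - $H$ is serializable if $C(H)$ is equivalent to some serial history. **Reactor model.** Reactor names and sub-transaction identifiers are natural numbers. Every reactor $k$ has its own set of data items, and data items in different reactors are disjoint. $ST_{i,j}^{k}$ denotes sub-transaction $j$ of transaction $T_i$, executing on reactor $k$. $r_{i,j}^{k}[x]$ and $w_{i,j}^{k}[x]$ denote a read and a write of data item $x$ of reactor $k$ in $ST_{i,j}^k$; these are called basic operations. Sub-transactions are finite and nested to finite depth, and each sub-transaction of $T_i$ (identified by $j$) occurs at exactly one place in the nesting structure of $T_i$. Over all its (nested) sub-transactions, a transaction contains at most one read and at most one write of any given data item of any given reactor. *Sub-transaction.* $ST_{i,j}^{k}$ is a partial order with relation $<_{i,j}$ where: 1. $ST_{i,j}^{k}\subseteq\{r_{i,j}^{k}[x],\,w_{i,j}^{k}[x],\,ST_{i,j'}^{k'} \mid x \text{ a data item in } k,\ j' \text{ a sub-transaction identifier with } j'\ne j\}$; 2. Let $\mathrm{basic\_ops}(r_{i,j}^{k}[x])=\{r_{i,j}^{k}[x]\}$, $\mathrm{basic\_ops}(w_{i,j}^{k}[x])=\{w_{i,j}^{k}[x]\}$, and $\mathrm{basic\_ops}(ST_{i,j}^{k})=\bigcup_{o\in ST_{i,j}^{k}}\mathrm{basic\_ops}(o)$. If $o_1\neq o_2$ are elements of $ST_{i,j}^k$ with $r_{i,j'}^{k'}[x]\in\mathrm{basic\_ops}(o_1)$ and $w_{i,j''}^{k'}[x]\in\mathrm{basic\_ops}(o_2)$, then $o_1<_{i,j}o_2$ or $o_2<_{i,j}o_1$.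 *Transaction.* $T_i$ is a partial order with relation $<_i$ where: 1. $T_i\subseteq\{ST_{i,j}^{k}\}\cup\{a_i,c_i\}$; 2. $a_i\in T_i\iff c_i\notin T_i$; 3. if $t$ is whichever of $c_i,a_i$ is in $T_i$, then $p<_i t$ for every other $p\in T_i$; 4. if $o_1\ne o_2$ are elements of $T_i$ not in $\{a_i,c_i\}$ with $r_{i,j'}^{k'}[x]\in\mathrm{basic\_ops}(o_1)$ and $w_{i,j''}^{k'}[x]\in\mathrm{basic\_ops}(o_2)$, then $o_1<_i o_2$ or $o_2<_i o_1$. *Conflicts, histories.* In the reactor model, two sub-transactions conflict iff the basic operations of at least one of them contain a write and the basic operations of both of them reference the same named item in the same reactor. Under this notion of conflict, the definitions of history, serial history, equivalence of histories and serializable history in the reactor model are those given above, with sub-transactions replacing basic operations: the operations of $T_i$ are its elements (sub-transactions together with the commit or abort), and conflict means conflict of sub-transactions. **Projection from the reactor model to the classic model.** *Basic operations.* $P(r_{i,j}^{k}[x])=r_i[k\circ x]$, $P(w_{i,j}^{k}[x])=w_i[k\circ x]$, $P(c_i)=c_i$, $P(a_i)=a_i$, where $k\circ x$ is the concatenation of the reactor identifier with the item name, serving as the name of item $x$ of reactor $k$ in a single address space (distinct pairs $(k,x)$ get distinct names). *Sub-transactions.* $P_S(ST_{i,j}^{k})$ is the set $\{P(o)\mid o\in\mathrm{basic\_ops}(ST_{i,j}^{k})\}$ with order $<_S^{i,j}$ such that (an inequality involving a set means that it holds for all elements of the set): - if $o_1,o_2\in ST_{i,j}^k$ are reads or writes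 and $o_1<_{i,j}o_2$, then $P(o_1)<_S^{i,j}P(o_2)$; - if $ST_{i,j'}^{k'}\in ST_{i,j}^{k}$, then $<_S^{i,j}$ is extended by $<_S^{i,j'}$; - if $o_1\in ST_{i,j}^k$ is a read or write, $ST_{i,j'}^{k'}\in ST_{i,j}^k$ and $o_1<_{i,j}ST_{i,j'}^{k'}$, then $P(o_1)<_S^{i,j}P_S(ST_{i,j'}^{k'})$; - if $ST_{i,j'}^{k'}\in ST_{i,j}^k$, $o_2\in ST_{i,j}^k$ is a read or write and $ST_{i,j'}^{k'}<_{i,j}o_2$, then $P_S(ST_{i,j'}^{k'})<_S^{i,j}P(o_2)$; - if $ST_{i,j'}^{k'},ST_{i,j''}^{k''}\in ST_{i,j}^k$ and $ST_{i,j'}^{k'}<_{i,j}ST_{i,j''}^{k''}$, then $P_S(ST_{i,j'}^{k'})<_S^{i,j}P_S(ST_{i,j''}^{k''})$. *Transactions.* $P_T(T_i)$ is the set $\bigcup_{ST_{i,j}^{k}\in T_i}P_S(ST_{i,j}^{k})\cup\{P(o)\mid o\in T_i \text{ is a commit or abort}\}$ with order $<_T^i$ such that: - $<_T^i$ is extended by $\bigcup_{ST_{i,j}^{k}\in T_i}<_S^{i,j}$; - if $ST_{i,j}^{k},ST_{i,j'}^{k'}\in T_i$, $ST_{i,j}^{k}<_i ST_{i,j'}^{k'}$, $o_1\in P_S(ST_{i,j}^{k})$ and $o_2\in P_S(ST_{i,j'}^{k'})$, then $o_1<_T^i o_2$; - if $t$ is whichever of $c_i,a_i$ is in $P_T(T_i)$,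 then $p<_T^i t$ for every other $p\in P_T(T_i)$. *Histories.* For a history $H$ over $\{T_1,\dots,T_n\}$ in the reactor model, with order $<_H$, the projection $P(H)$ is the partial order over the set of transactions $\{P_T(T_1),\dots,P_T(T_n)\}$ with underlying set $\bigcup_{i=1}^n P_T(T_i)$ and ordering relation $<_{P_H}$ such that: - $<_{P_H}$ is extended by $\bigcup_{i=1}^n<_T^i$; - if $ST_{i,j}^{k}\in T_i$, $ST_{i',j'}^{k'}\in T_{i'}$, $ST_{i,j}^{k}<_H ST_{i',j'}^{k'}$, $o_1\in P_S(ST_{i,j}^{k})$, $o_2\in P_S(ST_{i',j'}^{k'})$, and $o_1,o_2$ conflict, then $o_1<_{P_H}o_2$.
   Formalization: Two sub-transactions are taken to conflict only if at least one of them writes the very item that both reference; if a write of an unrelated item sufficed, as the definition literally reads, the equivalence would fail. *)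

(* Defs.v *)
From mathcomp Require Import all_boot.
From mathcomp Require Import boolp classical_sets cardinality.

Set Implicit Arguments.
Unset Strict Implicit.
Unset Printing Implicit Defensive.

Local Open Scope classical_set_scope.

Record poset (A : Type) := Poset {
  carrier : set A;
  prec : A -> A -> Prop }.

Definition is_poset (A : Type) (P : poset A) : Prop :=
  [/\ forall x y, prec P x y -> carrier P x /\ carrier P y,
      forall x, ~ prec P x x &
      forall x y z, prec P x y -> prec P y z -> prec P x z].

(* Operations carry the index of their transaction; [is_txn i T] says that [T]
   is a well-formed transaction with index [i]. *)
Record model := Model {
  op : Type;
  is_txn : nat -> poset op -> Prop;
  commit : nat -> op;
  abort : nat -> op;
  conflict : op -> op -> Prop }.
Arguments is_txn : clear implicits.
Arguments commit : clear implicits.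
Arguments abort : clear implicits.

Record history (M : model) := History {
  h_ids : set nat;
  h_txn : nat -> poset (op M);
  h_po : poset (op M) }.

Section Histories.
Variable M : model.
Implicit Types H : history M.

Definition is_history H : Prop :=
  [/\ finite_set (h_ids H) /\
        (forall i, h_ids H i -> is_txn M i (h_txn H i)),
      is_poset (h_po H),
      carrier (h_po H) = \bigcup_(i in h_ids H) carrier (h_txn H i),
      forall i, h_ids H i ->
        forall p q, prec (h_txn H i) p q -> prec (h_po H) p q &
      forall p q, carrier (h_po H) p -> carrier (h_po H) q -> p <> q ->
        conflict p q -> prec (h_po H) p q \/ prec (h_po H) q p].

Definition all_before H (i i' : nat) : Prop :=
  forall p q, carrier (h_txn H i) p -> carrier (h_txn H i') q ->
    prec (h_po H) p q.

Definition serial H : Prop :=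
  forall i i', h_ids H i -> h_ids H i' -> i <> i' ->
    all_before H i i' \/ all_before H i' i.

Definition nonaborted_op H (p : op M) : Prop :=
  exists i, [/\ h_ids H i, ~ carrier (h_txn H i) (abort M i) &
                carrier (h_txn H i) p].

Definition equivalent H1 H2 : Prop :=
  [/\ is_history H1, is_history H2,
      h_ids H1 = h_ids H2 /\
        (forall i, h_ids H1 i -> h_txn H1 i = h_txn H2 i) &
      forall p q, nonaborted_op H1 p -> nonaborted_op H1 q -> conflict p q ->
        (prec (h_po H1) p q <-> prec (h_po H2) p q)].

Definition committed_projection H : history M :=
  let ids := [set i | h_ids H i /\ carrier (h_txn H i) (commit M i)] in
  let ops := \bigcup_(i in ids) carrier (h_txn H i) in
  History ids (h_txn H)
    (Poset ops (fun p q => [/\ ops p, ops q & prec (h_po H) p q])).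

Definition serializable H : Prop :=
  exists Hs, serial Hs /\ equivalent (committed_projection H) Hs.

End Histories.

Inductive classic_op (Name : Type) :=
| CRead (i : nat) (x : Name)
| CWrite (i : nat) (x : Name)
| CCommit (i : nat)
| CAbort (i : nat).
Arguments CCommit {Name} i.
Arguments CAbort {Name} i.

Section Classic.
Variable Name : Type.
Implicit Types (o : classic_op Name) (T : poset (classic_op Name)).

Definition classic_index o : nat :=
  match o with
  | CRead i _ | CWrite i _ | CCommit i | CAbort i => i
  end.

Definition classic_references o (x : Name) : Prop :=
  match o with
  | CRead _ y | CWrite _ y => y = x
  | _ => False
  end.

Definition classic_is_write o : Prop :=
  match o with CWrite _ _ => True | _ => False end.

Definition classic_conflict o1 o2 : Prop :=
  (classic_is_write o1 \/ classic_is_write o2) /\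
  exists x, classic_references o1 x /\ classic_references o2 x.

(* "At most one read and one write per item" is automatic here: [carrier T] is
   a set and a read or write is determined by [i] and the item. *)
Definition is_classic_txn (i : nat) T : Prop :=
  [/\ finite_set (carrier T) /\ is_poset T,
      forall o, carrier T o -> classic_index o = i,
      carrier T (CAbort i) <-> ~ carrier T (CCommit i),
      forall t, t = CCommit i \/ t = CAbort i -> carrier T t ->
        forall p, carrier T p -> p <> t -> prec T p t &
      forall x, carrier T (CRead i x) -> carrier T (CWrite i x) ->
        prec T (CRead i x) (CWrite i x) \/ prec T (CWrite i x) (CRead i x)].

Definition classic_model : model :=
  Model is_classic_txn CCommit CAbort classic_conflict.

End Classic.

(* [ST i j k] is the name of the sub-transaction ST_{i,j}^k; its elements and
   order are given by an assignment [body] of posets to names. *)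
Inductive stid := ST (i j k : nat).

(* [Read (ST i j k) x] is r_{i,j}^k[x]. *)
Inductive basic_op (X : Type) :=
| Read (s : stid) (x : X)
| Write (s : stid) (x : X).

Inductive sub_op (X : Type) :=
| Basic (b : basic_op X)
| Nested (s : stid).
Arguments Nested {X} s.

Inductive txn_op :=
| Sub (s : stid)
| RCommit (i : nat)
| RAbort (i : nat).

Section Reactor.
Variable X : Type.
(* [items k] are the items of reactor [k]. An item of the database is a pair
   [(k, x)], so different reactors never share items, even under equal names. *)
Variable items : nat -> set X.
Variable body : stid -> poset (sub_op X).
Implicit Types (s : stid) (o : sub_op X) (b : basic_op X) (T : poset txn_op).

Inductive basic_ops : sub_op X -> set (basic_op X) :=
| basic_ops_basic b : basic_ops (Basic b) b
| basic_ops_nested s o b :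
    carrier (body s) o -> basic_ops o b -> basic_ops (Nested s) b.

Definition sub_elem (s : stid) (o : sub_op X) : Prop :=
  let: ST i j k := s in
  match o with
  | Basic (Read s' x) | Basic (Write s' x) => s' = s /\ items k x
  | Nested (ST i' j' _) => i' = i /\ j' <> j
  end.

Definition is_subtxn (s : stid) : Prop :=
  [/\ finite_set (carrier (body s)), is_poset (body s),
      forall o, carrier (body s) o -> sub_elem s o &
      let: ST i _ _ := s in
      forall o1 o2 j' j'' k' x,
        carrier (body s) o1 -> carrier (body s) o2 -> o1 <> o2 ->
        basic_ops o1 (Read (ST i j' k') x) ->
        basic_ops o2 (Write (ST i j'' k') x) ->
        prec (body s) o1 o2 \/ prec (body s) o2 o1].

Inductive sub_of (T : poset txn_op) : stid -> Prop :=
| sub_of_top s : carrier T (Sub s) -> sub_of T s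
| sub_of_nested s s' :
    sub_of T s -> carrier (body s) (Nested s') -> sub_of T s'.

(* A place in the nesting structure of [T] is the top level ([None]) or the
   inside of one of the sub-transactions of [T]. *)
Definition occurs_at T (place : option stid) (s : stid) : Prop :=
  match place with
  | None => carrier T (Sub s)
  | Some s0 => sub_of T s0 /\ carrier (body s0) (Nested s)
  end.

Definition txn_elem (i : nat) (p : txn_op) : Prop :=
  match p with
  | Sub (ST i' _ _) => i' = i
  | RCommit i' | RAbort i' => i' = i
  end.

Definition txn_basic_ops T : set (basic_op X) :=
  [set b | exists2 s, carrier T (Sub s) & basic_ops (Nested s) b].

(* The standing assumptions on the sub-transactions of [T]. Since every body is
   finite, well-foundedness of nesting amounts to finite depth. *)
Definition well_nested (i : nat) T : Prop :=
  [/\ forall s, sub_of T s -> is_subtxn s,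
      forall s, sub_of T s ->
        Acc (fun s1 s2 => carrier (body s2) (Nested s1)) s,
      forall place place' j k k',
        occurs_at T place (ST i j k) -> occurs_at T place' (ST i j k') ->
        place = place' /\ k = k',
      forall j j' k x,
        txn_basic_ops T (Read (ST i j k) x) ->
        txn_basic_ops T (Read (ST i j' k) x) -> j = j' &
      forall j j' k x,
        txn_basic_ops T (Write (ST i j k) x) ->
        txn_basic_ops T (Write (ST i j' k) x) -> j = j'].

Definition is_reactor_txn (i : nat) T : Prop :=
  [/\ [/\ finite_set (carrier T), is_poset T & well_nested i T],
      forall p, carrier T p -> txn_elem i p,
      carrier T (RAbort i) <-> ~ carrier T (RCommit i),
      forall t, t = RCommit i \/ t = RAbort i -> carrier T t ->
        forall p, carrier T p -> p <> t -> prec T p t &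
      forall s1 s2 j' j'' k' x,
        carrier T (Sub s1) -> carrier T (Sub s2) -> s1 <> s2 ->
        basic_ops (Nested s1) (Read (ST i j' k') x) ->
        basic_ops (Nested s2) (Write (ST i j'' k') x) ->
        prec T (Sub s1) (Sub s2) \/ prec T (Sub s2) (Sub s1)].

Definition sub_writes s (k : nat) (x : X) : Prop :=
  exists i j, basic_ops (Nested s) (Write (ST i j k) x).

Definition sub_references s (k : nat) (x : X) : Prop :=
  sub_writes s k x \/ exists i j, basic_ops (Nested s) (Read (ST i j k) x).

(* The write is a write of the item that both sub-transactions reference, as
   for conflicts of basic operations: sharing a read-only item while writing
   some unrelated item is not a conflict. *)
Definition reactor_conflict (p q : txn_op) : Prop :=
  match p, q with
  | Sub s1, Sub s2 =>
      exists k x, [/\ sub_writes s1 k x \/ sub_writes s2 k x,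
                      sub_references s1 k x & sub_references s2 k x]
  | _, _ => False
  end.

Definition reactor_model : model :=
  Model is_reactor_txn RCommit RAbort reactor_conflict.

(* The concatenation k o x is the pair [(k, x)]. *)
Definition proj_basic b : classic_op (nat * X) :=
  match b with
  | Read (ST i _ k) x => CRead i (k, x)
  | Write (ST i _ k) x => CWrite i (k, x)
  end.

Definition proj_sub_ops s : set (classic_op (nat * X)) :=
  [set proj_basic b | b in basic_ops (Nested s)].

Inductive proj_sub_lt : stid ->
    classic_op (nat * X) -> classic_op (nat * X) -> Prop :=
| psl_basic_basic s b1 b2 :
    carrier (body s) (Basic b1) -> carrier (body s) (Basic b2) ->
    prec (body s) (Basic b1) (Basic b2) ->
    proj_sub_lt s (proj_basic b1) (proj_basic b2)
| psl_inner s s' p q :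
    carrier (body s) (Nested s') -> proj_sub_lt s' p q -> proj_sub_lt s p q
| psl_basic_nested s b1 s2 q :
    carrier (body s) (Basic b1) -> carrier (body s) (Nested s2) ->
    prec (body s) (Basic b1) (Nested s2) -> proj_sub_ops s2 q ->
    proj_sub_lt s (proj_basic b1) q
| psl_nested_basic s s1 b2 p :
    carrier (body s) (Nested s1) -> carrier (body s) (Basic b2) ->
    prec (body s) (Nested s1) (Basic b2) -> proj_sub_ops s1 p ->
    proj_sub_lt s p (proj_basic b2)
| psl_nested_nested s s1 s2 p q :
    carrier (body s) (Nested s1) -> carrier (body s) (Nested s2) ->
    prec (body s) (Nested s1) (Nested s2) ->
    proj_sub_ops s1 p -> proj_sub_ops s2 q -> proj_sub_lt s p q
| psl_trans s p q r :
    proj_sub_lt s p q -> proj_sub_lt s q r -> proj_sub_lt s p r.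

Definition proj_sub s : poset (classic_op (nat * X)) :=
  Poset (proj_sub_ops s) (proj_sub_lt s).

Definition proj_txn_ops (i : nat) T : set (classic_op (nat * X)) :=
  [set p | [\/ exists2 s, carrier T (Sub s) & carrier (proj_sub s) p,
               p = CCommit i /\ carrier T (RCommit i) |
               p = CAbort i /\ carrier T (RAbort i)]].

Inductive proj_txn_lt (i : nat) (T : poset txn_op) :
    classic_op (nat * X) -> classic_op (nat * X) -> Prop :=
| ptl_inner s p q :
    carrier T (Sub s) -> prec (proj_sub s) p q -> proj_txn_lt i T p q
| ptl_sub_sub s s' p q :
    carrier T (Sub s) -> carrier T (Sub s') -> prec T (Sub s) (Sub s') ->
    carrier (proj_sub s) p -> carrier (proj_sub s') q -> proj_txn_lt i T p q
| ptl_end t p :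
    t = CCommit i \/ t = CAbort i -> proj_txn_ops i T t ->
    proj_txn_ops i T p -> p <> t -> proj_txn_lt i T p t
| ptl_trans p q r :
    proj_txn_lt i T p q -> proj_txn_lt i T q r -> proj_txn_lt i T p r.

Definition proj_txn (i : nat) T : poset (classic_op (nat * X)) :=
  Poset (proj_txn_ops i T) (proj_txn_lt i T).

Inductive proj_history_lt (H : history reactor_model) :
    classic_op (nat * X) -> classic_op (nat * X) -> Prop :=
| phl_inner i p q :
    h_ids H i -> prec (proj_txn i (h_txn H i)) p q -> proj_history_lt H p q
| phl_conflict i i' s s' p q :
    h_ids H i -> h_ids H i' ->
    carrier (h_txn H i) (Sub s) -> carrier (h_txn H i') (Sub s') ->
    prec (h_po H) (Sub s) (Sub s') ->
    carrier (proj_sub s) p -> carrier (proj_sub s') q ->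
    classic_conflict p q -> proj_history_lt H p q
| phl_trans p q r :
    proj_history_lt H p q -> proj_history_lt H q r -> proj_history_lt H p r.

Definition proj_history (H : history reactor_model) :
    history (classic_model (nat * X)) :=
  @History (classic_model (nat * X)) (h_ids H)
    (fun i => proj_txn i (h_txn H i))
    (Poset (\bigcup_(i in h_ids H) carrier (proj_txn i (h_txn H i)))
       (proj_history_lt H)).

End Reactor.

(* Main.v *)
(* In either model a history is serializable iff the committed transactions
   carry a strict total order extending the conflict edges [i -> j], where some
   operation of [T_i] precedes a conflicting operation of [T_j]. So it suffices
   that [H] and [P(H)] have the same conflict edges. Two sub-transactions
   conflict iff they contain conflicting basic operations, hence edges of [H]
   project. Conversely, since every basic operation lies in exactly one
   top-level sub-transaction, each inequality of [P(H)] holds inside a single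
   top-level sub-transaction or lifts to an inequality of [H]. *)
Require Import Defs.
From mathcomp Require Import all_boot.
From mathcomp Require Import boolp classical_sets cardinality.

Set Implicit Arguments.
Unset Strict Implicit.
Unset Printing Implicit Defensive.

Local Open Scope classical_set_scope.

(* [mathcomp] has a [Sub] of its own, imported after [Defs]. *)
Local Notation Sub := Defs.Sub.

(** * Serialization orders *)

Section Serialization.
Variable M : model.
Implicit Types H : history M.

(** The features shared by both models from which the characterization of serializability follows.
    The index [idx] makes the transactions of a history pairwise disjoint. *)
Record regular (idx : op M -> nat) : Prop := Regular {
  regular_conflictC : forall p q : op M, conflict p q -> conflict q p;
  regular_poset : forall i T, is_txn M i T -> is_poset T;
  regular_index : forall i T p, is_txn M i T -> carrier T p -> idx p = i;
  regular_conflict : forall i T p q, is_txn M i T -> carrier T p ->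
    carrier T q -> p <> q -> conflict p q -> prec T p q \/ prec T q p;
  regular_abort : forall i T, is_txn M i T ->
    (carrier T (abort M i) <-> ~ carrier T (commit M i)) }.

(** The edges of the serialization graph, self-loops included. *)
Definition conflict_edge H (i j : nat) : Prop :=
  exists p q, [/\ carrier (h_txn H i) p, carrier (h_txn H j) q,
                  conflict p q & prec (h_po H) p q].

Definition committed H : set nat := h_ids (committed_projection H).

(** A topological sort of the serialization graph of the committed transactions. Self-loops are
    exempted by [i <> j], since a transaction may order conflicting operations of its own. *)
Definition serialization_order H (lt : nat -> nat -> Prop) : Prop :=
  [/\ forall i, committed H i -> ~ lt i i,
      forall i j k, committed H i -> committed H j -> committed H k ->
        lt i j -> lt j k -> lt i k,
      forall i j, committed H i -> committed H j -> i <> j ->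
        lt i j \/ lt j i &
      forall i j, committed H i -> committed H j -> i <> j ->
        conflict_edge H i j -> lt i j].

Variable idx : op M -> nat.
Hypothesis regM : regular idx.

Lemma committed_projection_history H :
  is_history H -> is_history (committed_projection H).
Proof.
case=> [[fin txnH] [_ irr tr] carH incl conf].
have sub p : carrier (h_po (committed_projection H)) p -> carrier (h_po H) p.
  by case=> i [idi _] ip; rewrite carH; exists i.
split => //=.
- split; last by move=> i [/txnH].
  by apply: sub_finite_set fin => i [].
- split=> [x y []//|x [_ _ /irr]//|x y z [? ? xy] [? ? yz]].
  by split => //; apply: tr xy yz.
- move=> i ci p q pq; have [ci1 _] := ci.
  have [/(_ _ _ pq)[ip iq] _ _] := regular_poset regM (txnH _ ci1).
  by split; [exists i|exists i|apply: incl ci1 _ _ pq].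
- move=> p q cp cq pq /(conf _ _ (sub _ cp) (sub _ cq) pq).
  by case=> ?; [left|right].
Qed.

Lemma committed_nonaborted H i p : is_history H -> committed H i ->
  carrier (h_txn H i) p -> nonaborted_op (committed_projection H) p.
Proof.
move=> [[_ txnH] _ _ _ _] ci ip; exists i; split => //.
by have [idi cmi] := ci => /(regular_abort regM (txnH _ idi)).
Qed.

(** A serial history arranges its transactions in blocks, so comparing one representative of each is
    enough. The commit is an operation that every committed transaction has. *)
Lemma serialization_order_of_serial H Hs : is_history H -> serial Hs ->
  equivalent (committed_projection H) Hs ->
  serialization_order H (fun i j => prec (h_po Hs) (commit M i) (commit M j)).
Proof.
move=> histH serHs [_ [_ [_ irr tr] _ _ _] [ids txns] eqv].
have before i j : committed H i -> committed H j -> all_before Hs i j ->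
    forall p q, carrier (h_txn H i) p -> carrier (h_txn H j) q ->
    prec (h_po Hs) p q.
  by move=> ci cj ij p q ip jq; apply: ij; rewrite -txns.
have ord i j : committed H i -> committed H j -> i <> j ->
    all_before Hs i j \/ all_before Hs j i.
  by move=> ci cj; apply: serHs; rewrite -ids.
split=> [i _|i j k _ _ _|i j ci cj nij|i j ci cj nij [p [q [ip jq pq ltpq]]]].
- exact: irr.
- exact: tr.
- case: (ord _ _ ci cj nij) => [ij|ji].
    by left; apply: before ij _ _ (proj2 ci) (proj2 cj).
  by right; apply: before ji _ _ (proj2 cj) (proj2 ci).
- case: (ord _ _ ci cj nij) => [ij|ji].
    by apply: before ij _ _ (proj2 ci) (proj2 cj).
  (* If the block of [j] came first, [q] would precede [p] in [Hs], while equivalence puts [p]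
     before [q] there. *)
  have qp := before _ _ cj ci ji _ _ jq ip.
  case: (irr q); apply: tr qp _.
  apply/(eqv _ _ _ _ pq); [exact: committed_nonaborted histH ci ip|
    exact: committed_nonaborted histH cj jq|].
  by split => //; [exists i|exists j].
Qed.

(** A lexicographic order: transactions are compared by [lt], and operations of one transaction by
    the order of that transaction. *)
Definition serial_history H (lt : nat -> nat -> Prop) : history M :=
  let C := carrier (h_po (committed_projection H)) in
  History (committed H) (h_txn H)
    (Poset C (fun p q => [/\ C p, C q &
       lt (idx p) (idx q) \/
       idx p = idx q /\ prec (h_txn H (idx p)) p q])).

Section SerialHistory.
Variables (H : history M) (lt : nat -> nat -> Prop).
Hypotheses (histH : is_history H) (ltH : serialization_order H lt).

Let txnH i : committed H i -> is_txn M i (h_txn H i).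
Proof. by case: histH => -[_ h] _ _ _ _ [/h]. Qed.

Let idxH i p : committed H i -> carrier (h_txn H i) p -> idx p = i.
Proof. by move=> /txnH; apply: regular_index. Qed.

Lemma serial_history_serial : serial (serial_history H lt).
Proof.
case: ltH => _ _ tot _ i j ci cj nij.
have before k l : committed H k -> committed H l -> lt k l ->
    all_before (serial_history H lt) k l.
  move=> ck cl kl p q kp lq; split; [by exists k|by exists l|left].
  by rewrite (idxH ck kp) (idxH cl lq).
by case: (tot _ _ ci cj nij); [left|right]; apply: before.
Qed.

Lemma serial_history_history : is_history (serial_history H lt).
Proof.
case: ltH => irr tr tot edge.
have [[fin _] _ _ incl conf] := committed_projection_history histH.
have poH i ci := regular_poset regM (@txnH i ci).
split => //=.
- split=> [x y []//|x [[i ci ip] _ []]|x y z [cx cy xy] [_ cz yz]].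
  + by rewrite (idxH ci ip); apply: irr.
  + by rewrite (idxH ci ip) => -[_]; have [_ h _] := poH i ci; apply: h.
  + split => //; case: cx cy cz xy yz => i ci ix [j cj jy] [k ck kz].
    rewrite (idxH ci ix) (idxH cj jy) (idxH ck kz).
    case=> [ij|[<- xy]]; case=> [jk|[<- yz]]; [|by left..|].
      by left; apply: tr ij jk.
    by right; split => //; have [_ _ h] := poH i ci; apply: h xy yz.
- move=> i ci p q pq; have [/(_ _ _ pq)[ip iq] _ _] := poH i ci.
  split; [by exists i|by exists i|right].
  by rewrite !(idxH ci).
- move=> p q [i ci ip] [j cj jq] npq pq.
  have [eij|nij] := pselect (i = j).
    subst j; have lift x y : prec (h_txn H i) x y ->
        prec (h_po (serial_history H lt)) x y.
      move=> xy; have [/(_ _ _ xy)[ix iy] _ _] := poH i ci.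
      by split; [exists i|exists i|right; rewrite !(idxH ci)].
    by case: (regular_conflict regM (txnH ci) ip jq npq pq) => /lift;
      [left|right].
  by case: (tot _ _ ci cj nij) => lij; [left|right]; split;
    [exists i|exists j| |exists j|exists i|] => //;
    left; rewrite (idxH ci ip) (idxH cj jq).
Qed.

(** Between distinct transactions the inequality is a conflict edge, which [lt] respects. Inside one
    transaction the conflicting pair is already ordered, and the opposite order would contradict
    that of [H]. *)
Lemma serial_history_extends p q : conflict p q ->
  prec (h_po (committed_projection H)) p q ->
  prec (h_po (serial_history H lt)) p q.
Proof.
case: ltH => irr tr tot edge pq /= [cp cq ltpq]; split => //.
case: cp cq => i ci ip [j cj jq].
rewrite (idxH ci ip) (idxH cj jq).
have [eij|nij] := pselect (i = j); last first.
  by left; apply: edge => //; exists p, q.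
subst j; right; split => //.
have [_ [_ irrH trH] _ incl _] := histH.
have npq : p <> q by move=> epq; move: ltpq; rewrite epq; apply: irrH.
case: (regular_conflict regM (txnH ci) ip jq npq pq) => // qp.
by case: (irrH p); apply: trH ltpq _; apply: incl qp; case: ci.
Qed.

Lemma serial_history_equivalent :
  equivalent (committed_projection H) (serial_history H lt).
Proof.
have hC := committed_projection_history histH.
have hS := serial_history_history.
split => // p q [i [ci _ ip]] [j [cj _ jq]] pq.
split; first exact: serial_history_extends.
have [_ [_ irrS trS] _ _ _] := hS => ltpq.
have npq : p <> q by move=> epq; move: ltpq; rewrite epq; apply: irrS.
have [_ _ _ _ conf] := hC.
have Cp : carrier (h_po (committed_projection H)) p by exists i.
have Cq : carrier (h_po (committed_projection H)) q by exists j.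
(* The committed projection orders the pair one way or the other; the wrong way would carry over to
   the serial history and close a cycle there. *)
case: (conf _ _ Cp Cq npq pq) => // qp.
case: (irrS p); apply: trS ltpq _.
by apply: serial_history_extends qp; apply: regular_conflictC regM _ _ pq.
Qed.

End SerialHistory.

(** The right-hand side sees a history only through its committed transactions and its conflict
    edges, so it can be compared across the two models. *)
Lemma serializableP H : is_history H ->
  serializable H <-> exists lt, serialization_order H lt.
Proof.
move=> histH; split=> [[Hs [serHs eqv]]|[lt ltH]].
  by eexists; apply: serialization_order_of_serial eqv.
exists (serial_history H lt); split; first exact: serial_history_serial.
exact: serial_history_equivalent.
Qed.

End Serialization.

(** * Conflicts in the classic model *)

Section ClassicRegular.
Variable Name : Type.

(** A write is determined by its index and its item, so two conflicting writes of one transaction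
    would be equal. *)
Lemma classic_conflict_same_index i (p q : classic_op Name) :
  classic_index p = i -> classic_index q = i -> p <> q ->
  classic_conflict p q ->
  exists x, p = CRead i x /\ q = CWrite i x \/ p = CWrite i x /\ q = CRead i x.
Proof.
move=> ep eq npq [w [x [px qx]]]; exists x; move: ep eq w px qx npq.
case: p => [i1 x1|i1 x1|//|//]; case: q => [i2 x2|i2 x2|//|//] /=;
  move=> -> -> w -> -> npq; [by case: w|by left|by right|by case: npq].
Qed.

Lemma classic_regular :
  @regular (classic_model Name) (@classic_index Name).
Proof.
split=> /=.
- move=> p q [w [x [px qx]]]; split; last by exists x.
  by case: w; [right|left].
- by move=> i T [[]].
- by move=> i T p [_ idx _ _ _]; apply: idx.
- move=> i T p q [_ idx _ _ rw] Tp Tq npq pq.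
  have [x [] [? ?]] :=
    classic_conflict_same_index (idx _ Tp) (idx _ Tq) npq pq; subst p q.
    exact: rw.
  by case: (rw x Tq Tp); [right|left].
- by move=> i T [].
Qed.

End ClassicRegular.

(** * Nesting of sub-transactions *)

Section Reactor.
Variables (X : Type) (items : nat -> set X) (body : stid -> poset (sub_op X)).
Implicit Types (s r : stid) (o : sub_op X) (b : basic_op X).
Implicit Types (p q : classic_op (nat * X)) (a : txn_op).

Local Notation child := (fun s1 s2 => carrier (body s2) (Nested s1)).
Local Notation basic_ops := (basic_ops body).
Local Notation sub_of := (sub_of body).
Local Notation occurs_at := (occurs_at body).
Local Notation txn_basic_ops := (txn_basic_ops body).
Local Notation proj_sub_ops := (proj_sub_ops body).
Local Notation proj_sub_lt := (proj_sub_lt body).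
Local Notation is_reactor_txn := (is_reactor_txn items body).

Definition st_index s : nat := let: ST i _ _ := s in i.

Definition basic_st b : stid := match b with Read s _ | Write s _ => s end.

Definition txn_op_index a : nat :=
  match a with Sub s => st_index s | RCommit i | RAbort i => i end.

(** The reflexive and transitive closure of nesting, with [s] as the outer end. Steps are added at
    the inner end; [within_child] and [within_inv] work at the outer end. *)
Inductive within s : stid -> Prop :=
| within_refl : within s s
| within_step r r' : within s r -> child r' r -> within s r'.

Lemma within_child s s' r : child s' s -> within s' r -> within s r.
Proof.
move=> ss' sr; elim: sr => [|r1 r2 _ IH r12].
  exact: within_step (within_refl s) ss'.
exact: within_step IH r12.
Qed.

Lemma within_inv s r :
  within s r -> s = r \/ exists2 s', child s' s & within s' r.
Proof.
elim=> [|r1 r2 _ IH r12]; first by left.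
right; case: IH => [->|[s' ss' sr]].
  by exists r2 => //; apply: within_refl.
by exists s' => //; apply: within_step sr r12.
Qed.

(** A nesting cycle through [s] also passes through a child of [s], so it could be pushed down
    forever, against accessibility. *)
Lemma within_acyclic s : Acc child s -> forall r, within s r -> ~ child s r.
Proof.
elim=> {}s _ IH r sr rs.
case: (within_inv sr) => [er|[s' ss' s'r]].
  by subst r; apply: (IH s rs s (within_refl s)).
by apply: (IH s' ss' s) => //; apply: within_step s'r rs.
Qed.

(** Replaces the recursive descent of [basic_ops] by a chain of nestings that ends at the
    sub-transaction directly containing the operation. *)
Lemma basic_opsP o b : basic_ops o b ->
  match o with
  | Basic b' => b' = b
  | Nested s => exists2 r, within s r & carrier (body r) (Basic b)
  end.
Proof.
elim=> // s [b0|s'] {}b so _ => [<-|[r sr rb]].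
  by exists s => //; apply: within_refl.
by exists r => //; apply: within_child so sr.
Qed.

(** * Projected operations and conflicts *)

Lemma proj_sub_lt_ops s p q :
  proj_sub_lt s p q -> proj_sub_ops s p /\ proj_sub_ops s q.
Proof.
have basic r b : carrier (body r) (Basic b) -> proj_sub_ops r (proj_basic b).
  move=> rb; exists b => //.
  exact: basic_ops_nested rb (basic_ops_basic _ _).
have nested r r' x : child r' r -> proj_sub_ops r' x -> proj_sub_ops r x.
  by move=> rr' [b r'b <-]; exists b => //; apply: basic_ops_nested rr' r'b.
elim=> {s p q}.
- by move=> s b1 b2 sb1 sb2 _; split; apply: basic.
- by move=> s s' p q ss' _ [ps' qs']; split; apply: nested ss' _.
- move=> s b1 s2 q sb1 ss2 _ qs2; split; [exact: basic|exact: nested ss2 _].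
- move=> s s1 b2 p ss1 sb2 _ ps1; split; [exact: nested ss1 _|exact: basic].
- move=> s s1 s2 p q ss1 ss2 _ ps1 qs2.
  by split; [exact: nested ss1 _|exact: nested ss2 _].
- by move=> s p q r _ [ps _] _ [_ rs].
Qed.

Lemma proj_sub_ops_access s p : proj_sub_ops s p ->
  (exists i x, p = CRead i x) \/ (exists i x, p = CWrite i x).
Proof.
by case=> -[[i j k] x|[i j k] x] _ <-; [left|right]; exists i, (k, x).
Qed.

Lemma sub_writesP s k x :
  sub_writes body s k x <-> exists i, proj_sub_ops s (CWrite i (k, x)).
Proof.
split=> [[i [j sb]]|[i [[[i' j k'] x'|[i' j k'] x'] sb //= [_ <- <-]]]].
  by exists i, (Write (ST i j k) x).
by exists i', j.
Qed.

Lemma sub_referencesP s k x : sub_references body s k x <->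
  exists2 p, proj_sub_ops s p & classic_references p (k, x).
Proof.
split=> [[/sub_writesP[i sp]|[i [j sb]]]|[p [b sb <-]]].
- by exists (CWrite i (k, x)).
- by exists (CRead i (k, x)) => //; exists (Read (ST i j k) x).
- case: b sb => [[i j k'] x'|[i j k'] x'] sb /= [<- <-]; [right|left];
  by exists i, j.
Qed.

(** A write of [(k, x)] on one side conflicts with whichever operation makes the other side
    reference that item. *)
Lemma reactor_conflictP s1 s2 :
  reactor_conflict body (Sub s1) (Sub s2) <->
  exists p q, [/\ proj_sub_ops s1 p, proj_sub_ops s2 q & classic_conflict p q].
Proof.
split=> [[k [x [w ref1 ref2]]]|[p [q [s1p s2q [w [[k x] [px qx]]]]]]].
  case: w => /sub_writesP[i sp].
    have [q s2q qx] := proj1 (sub_referencesP _ _ _) ref2.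
    exists (CWrite i (k, x)), q; split => //.
    by split; [left|exists (k, x)].
  have [p s1p px] := proj1 (sub_referencesP _ _ _) ref1.
  exists p, (CWrite i (k, x)); split => //.
  by split; [right|exists (k, x)].
exists k, x; split; [|by apply/sub_referencesP; exists p|
                      by apply/sub_referencesP; exists q].
case: w => w; [left|right]; apply/sub_writesP.
  by case: p w s1p px => // i n _ /= + e; rewrite e; exists i.
by case: q w s2q qx => // i n _ /= + e; rewrite e; exists i.
Qed.

(** * Lifting inequalities between projected operations *)

Definition projects a p : Prop :=
  match a with
  | Sub s => proj_sub_ops s p
  | RCommit i => p = CCommit i
  | RAbort i => p = CAbort i
  end.

(** [Q] will be a transaction or a whole history. The second alternative covers inequalities
    internal to one sub-transaction, which the order of [Q] does not see. *)
Definition lifts_to (Q : poset txn_op) p q : Prop :=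
  exists a a', [/\ carrier Q a /\ projects a p, carrier Q a' /\ projects a' q &
    prec Q a a' \/ exists s, [/\ a = Sub s, a' = Sub s & proj_sub_lt s p q]].

Definition projects_inj (Q : poset txn_op) : Prop :=
  forall a a' p, carrier Q a -> carrier Q a' -> projects a p ->
    projects a' p -> a = a'.

(** By injectivity the middle operation [q] comes from a single element of [Q], where the two lifted
    inequalities meet. *)
Lemma lifts_to_trans Q p q t : is_poset Q -> projects_inj Q ->
  lifts_to Q p q -> lifts_to Q q t -> lifts_to Q p t.
Proof.
move=> [_ _ tr] inj [a [b [ap [Qb bq] ab]]] [b' [c [[Qb' b'q] ct bc]]].
have e := inj _ _ _ Qb Qb' bq b'q; subst b'; exists a, c; split => //.
case: ab bc => [ab|[s [ea eb ltpq]]] [bc|[s' [eb' ec ltqr]]].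
- by left; apply: tr ab bc.
- by left; rewrite ec -eb'.
- by left; rewrite ea -eb.
- right; exists s; split=> //; first by rewrite ec -eb' eb.
  have [e] : Sub s = Sub s' by rewrite -eb -eb'.
  by subst s'; apply: psl_trans ltpq ltqr.
Qed.

Lemma lifts_to_irr Q p : is_poset Q -> projects_inj Q ->
  (forall s, carrier Q (Sub s) -> ~ proj_sub_lt s p p) -> ~ lifts_to Q p p.
Proof.
move=> [_ irr _] inj irrs [a [b [[Qa ap] [Qb bp] ab]]].
have e := inj _ _ _ Qa Qb ap bp; subst b.
case: ab => [|[s [ea _]]]; first exact: irr.
by subst a; apply: irrs.
Qed.

Lemma lifts_to_sub Q Q' p q : (forall a, carrier Q a -> carrier Q' a) ->
  (forall a a', prec Q a a' -> prec Q' a a') ->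
  lifts_to Q p q -> lifts_to Q' p q.
Proof.
move=> QQ' ltQQ' [a [b [[/QQ' Qa ap] [/QQ' Qb bp] ab]]].
exists a, b; split => //.
by case: ab => [/ltQQ'|]; [left|right].
Qed.

(** * Unique location of operations in one transaction *)

Section Transaction.
Variables (i : nat) (T : poset txn_op).
Hypothesis txnT : is_reactor_txn i T.

Lemma sub_of_subtxn s : sub_of T s -> is_subtxn items body s.
Proof. by case: txnT => -[_ _ [h _ _ _ _]] _ _ _ _; apply: h. Qed.

Lemma sub_of_acc s : sub_of T s -> Acc child s.
Proof. by case: txnT => -[_ _ [_ h _ _ _]] _ _ _ _; apply: h. Qed.

(** A nested name has the same index as its parent, so the index descends from the top level. *)
Lemma sub_of_index s : sub_of T s -> st_index s = i.
Proof.
elim=> {s} [s Ts|s s' Ts <- ss'].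
  by case: txnT => _ /(_ _ Ts) + _ _ _; case: s Ts.
have [_ _ /(_ _ ss') + _] := sub_of_subtxn Ts.
by case: s s' {Ts ss'} => [i0 j k] [i' j' k'] [].
Qed.

Lemma sub_of_within s r : sub_of T s -> within s r -> sub_of T r.
Proof. by move=> Ts; elim=> // r1 r2 _ IH; apply: sub_of_nested. Qed.

(** A basic operation carries the name of its direct container, which locates it in the nesting
    structure. *)
Lemma sub_of_basic_st s b :
  sub_of T s -> carrier (body s) (Basic b) -> basic_st b = s.
Proof.
move=> Ts sb; have [_ _ /(_ _ sb) + _] := sub_of_subtxn Ts.
by case: s {Ts sb} => i0 j k; case: b => [s x|s x] [].
Qed.

Lemma basic_ops_within s b : sub_of T s -> basic_ops (Nested s) b ->
  within s (basic_st b) /\ sub_of T (basic_st b).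
Proof.
move=> Ts /basic_opsP[r sr rb].
have Tr := sub_of_within Ts sr.
by rewrite (sub_of_basic_st Tr rb).
Qed.

Lemma occurs_at_sub_of pl s : occurs_at T pl s -> sub_of T s.
Proof.
case: pl => [s0 [Ts0 ss0]|Ts]; first exact: sub_of_nested ss0.
exact: sub_of_top.
Qed.

(** Uniqueness of places is assumed only for names with index [i], which [sub_of_index] guarantees
    here. *)
Lemma occurs_at_inj pl pl' s :
  occurs_at T pl s -> occurs_at T pl' s -> pl = pl'.
Proof.
move=> o1 o2; have := sub_of_index (occurs_at_sub_of o1).
case: s o1 o2 => i0 j k o1 o2 /= e; subst i0.
by case: txnT => -[_ _ [_ _ /(_ _ _ _ _ _ o1 o2)[]]].
Qed.

(* Places are unique, so the chains of ancestors of [r] through [s1] and [s2]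
   coincide step by step; they cannot have different lengths because a shared
   place would then make the nesting cyclic. *)
Lemma within_sibling pl s1 s2 r : occurs_at T pl s1 -> occurs_at T pl s2 ->
  within s1 r -> within s2 r -> s1 = s2.
Proof.
have refl_step s s' r1 : occurs_at T pl s -> occurs_at T pl s' ->
    within s' r1 -> child s r1 -> False.
  move=> os os' s'r1 rs.
  have Tr1 := sub_of_within (occurs_at_sub_of os') s'r1.
  have epl : pl = Some r1 by apply: occurs_at_inj os _.
  subst pl; case: os' => _ r1s'.
  have Ts' := sub_of_nested Tr1 r1s'.
  exact: (within_acyclic (sub_of_acc Ts') s'r1 r1s').
move=> o1 o2 w1; elim: w1 => [|r1 r2 w1 IH r12] w2.
  case: w2 o1 => // r1 r2 w2 r12 o1.
  by case: (refl_step _ _ _ o1 o2 w2 r12).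
have Tr1 := sub_of_within (occurs_at_sub_of o1) w1.
case: w2 r12 o2 => [|r3 r4 w2 r34] r12 o2.
  by case: (refl_step _ _ _ o2 o1 w1 r12).
have Tr3 := sub_of_within (occurs_at_sub_of o2) w2.
have [e] : Some r1 = Some r3 by apply: (@occurs_at_inj _ _ r4).
by subst r3; apply: IH.
Qed.

(** The sub-transaction named in [b] lies within both [s1] and [s2], which are siblings at the top
    level. *)
Lemma top_basic_ops_inj s1 s2 b : carrier T (Sub s1) -> carrier T (Sub s2) ->
  basic_ops (Nested s1) b -> basic_ops (Nested s2) b -> s1 = s2.
Proof.
move=> Ts1 Ts2 /(basic_ops_within (sub_of_top _ Ts1))[w1 _].
move=> /(basic_ops_within (sub_of_top _ Ts2))[w2 _].
exact: (@within_sibling None _ _ (basic_st b)).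
Qed.

Lemma body_basic_ops_inj s o1 o2 b : sub_of T s ->
  carrier (body s) o1 -> carrier (body s) o2 ->
  basic_ops o1 b -> basic_ops o2 b -> o1 = o2.
Proof.
move=> Ts.
(* An operation both directly in [s] and inside a child of [s] would put [s] within its own
   child. *)
have no_cycle s1 : carrier (body s) (Nested s1) -> carrier (body s) (Basic b) ->
    basic_ops (Nested s1) b -> False.
  move=> ss1 sb s1b; have Ts1 := sub_of_nested Ts ss1.
  have [w _] := basic_ops_within Ts1 s1b.
  rewrite (sub_of_basic_st Ts sb) in w.
  exact: (within_acyclic (sub_of_acc Ts1) w ss1).
case: o1 o2 => [b1|s1] [b2|s2] so1 so2 ob1 ob2.
- by move/basic_opsP: ob1 => ->; move/basic_opsP: ob2 => ->.
- by move/basic_opsP: ob1 so1 => -> /(no_cycle _ so2).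
- by move/basic_opsP: ob2 so2 => -> /(no_cycle _ so1).
- have [w1 _] := basic_ops_within (sub_of_nested Ts so1) ob1.
  have [w2 _] := basic_ops_within (sub_of_nested Ts so2) ob2.
  by congr Nested; apply: (@within_sibling (Some s) _ _ (basic_st b)).
Qed.

Lemma sub_of_basic_ops s b :
  sub_of T s -> basic_ops (Nested s) b -> txn_basic_ops T b.
Proof.
move=> Ts; elim: Ts b => {s} [s Ts|s s' _ IH ss'] b sb; first by exists s.
by apply: IH; apply: basic_ops_nested ss' sb.
Qed.

Lemma txn_basic_ops_index b : txn_basic_ops T b -> st_index (basic_st b) = i.
Proof.
move=> [s Ts sb]; apply: sub_of_index.
by have [] := basic_ops_within (sub_of_top _ Ts) sb.
Qed.

(** Projection forgets the identifier [j]. It is recovered because a transaction has at most one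
    read and one write of each item of each reactor. *)
Lemma proj_basic_inj b1 b2 : txn_basic_ops T b1 -> txn_basic_ops T b2 ->
  proj_basic b1 = proj_basic b2 -> b1 = b2.
Proof.
move=> Tb1 Tb2; move: (txn_basic_ops_index Tb1) (txn_basic_ops_index Tb2).
have [[_ _ [_ _ _ readT writeT]] _ _ _ _] := txnT.
case: b1 b2 Tb1 Tb2 => -[i1 j1 k1] x1 [] [i2 j2 k2] x2 Tb1 Tb2 /= e1 e2 //;
  case=> _ ek ex; subst i1 i2 k2 x2.
  by rewrite (readT _ _ _ _ Tb1 Tb2).
by rewrite (writeT _ _ _ _ Tb1 Tb2).
Qed.

Lemma proj_sub_ops_inj s1 s2 p : carrier T (Sub s1) -> carrier T (Sub s2) ->
  proj_sub_ops s1 p -> proj_sub_ops s2 p -> s1 = s2.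
Proof.
move=> Ts1 Ts2 [b1 s1b1 <-] [b2 s2b2 /proj_basic_inj e].
apply: (top_basic_ops_inj Ts1 Ts2 s1b1).
by rewrite -e //; [exists s2|exists s1].
Qed.

(** * The projected order of a sub-transaction *)

Definition in_elem s o p : Prop :=
  carrier (body s) o /\ exists2 b, basic_ops o b & proj_basic b = p.

Lemma in_elem_inj s o1 o2 p : sub_of T s ->
  in_elem s o1 p -> in_elem s o2 p -> o1 = o2.
Proof.
move=> Ts [so1 [b1 o1b1 <-]] [so2 [b2 o2b2 /proj_basic_inj e]].
apply: (body_basic_ops_inj Ts so1 so2 o1b1).
rewrite -e //; apply: sub_of_basic_ops Ts _.
  exact: basic_ops_nested so2 o2b2.
exact: basic_ops_nested so1 o1b1.
Qed.

Lemma in_elemP s p : proj_sub_ops s p -> exists o, in_elem s o p.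
Proof.
case=> b sb <-; inversion sb as [|s' o b' so ob]; subst.
by exists o; split => //; exists b.
Qed.

(** Inverts the transitive closure. Consecutive links of a chain meet in the same element of the
    body, so the chain collapses to one comparison of elements or stays inside one nested
    sub-transaction. *)
Lemma proj_sub_lt_elem s p q : sub_of T s -> proj_sub_lt s p q ->
  exists o1 o2, [/\ in_elem s o1 p, in_elem s o2 q &
    prec (body s) o1 o2 \/
    exists s', [/\ o1 = Nested s', o2 = Nested s' & proj_sub_lt s' p q]].
Proof.
move=> Ts ltpq; elim: ltpq Ts => {s p q}.
- move=> s b1 b2 sb1 sb2 lt12 _; exists (Basic b1), (Basic b2).
  split; [| |by left]; split => //.
    by exists b1 => //; apply: basic_ops_basic.
  by exists b2 => //; apply: basic_ops_basic.
- move=> s s' p q ss' ltpq _ _; exists (Nested s'), (Nested s').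
  have [ps' qs'] := proj_sub_lt_ops ltpq.
  by split; [split|split|right; exists s'].
- move=> s b1 s2 q sb1 ss2 lt12 qs2 _; exists (Basic b1), (Nested s2).
  split; [|by split|by left]; split => //.
  by exists b1 => //; apply: basic_ops_basic.
- move=> s s1 b2 p ss1 sb2 lt12 ps1 _; exists (Nested s1), (Basic b2).
  split; [by split| |by left]; split => //.
  by exists b2 => //; apply: basic_ops_basic.
- move=> s s1 s2 p q ss1 ss2 lt12 ps1 qs2 _; exists (Nested s1), (Nested s2).
  by split; [split|split|left].
- move=> s p q r _ IH1 _ IH2 Ts.
  have [o1 [o2 [po1 qo2 lt12]]] := IH1 Ts.
  have [o3 [o4 [qo3 ro4 lt34]]] := IH2 Ts.
  have e23 := in_elem_inj Ts qo2 qo3; subst o3.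
  exists o1, o4; split => //.
  have [_ [_ _ tr] _ _] := sub_of_subtxn Ts.
  case: lt12 lt34 => [lt12|[s' [e1 e2 ltpq]]] [lt24|[s'' [e3 e4 ltqr]]].
  + by left; apply: tr lt12 lt24.
  + by left; rewrite e4 -e3.
  + by left; rewrite e1 -e2.
  + right; exists s'; split=> //; first by rewrite e4 -e3 e2.
    have [e] : Nested s' = Nested s'' :> sub_op X by rewrite -e2 -e3.
    by subst s''; apply: psl_trans ltpq ltqr.
Qed.

(** A loop at [p] would compare an element of the body with itself or recur one level deeper, which
    the induction on nesting excludes. *)
Lemma proj_sub_lt_irr s p : sub_of T s -> ~ proj_sub_lt s p p.
Proof.
move=> Ts; have acc := sub_of_acc Ts; elim: acc Ts => {}s _ IH Ts.
move=> /(proj_sub_lt_elem Ts)[o1 [o2 [po1 po2 lt12]]].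
have e := in_elem_inj Ts po1 po2; subst o2.
case: lt12 => [|[s' [es' _ ltpp]]].
  by have [_ [_ irr _] _ _] := sub_of_subtxn Ts; apply: irr.
case: po1 => so1 _; rewrite es' in so1.
by apply: IH ltpp => //; apply: sub_of_nested so1.
Qed.

(** Bodies are finite and nesting is well-founded. *)
Lemma finite_basic_ops s : sub_of T s -> finite_set (basic_ops (Nested s)).
Proof.
move=> Ts; have acc := sub_of_acc Ts; elim: acc Ts => {}s _ IH Ts.
have -> : basic_ops (Nested s) = \bigcup_(o in carrier (body s)) basic_ops o.
  apply/seteqP; split=> b.
    by move=> sb; inversion sb as [|s' o b' so ob]; subst; exists o.
  by case=> o so ob; apply: basic_ops_nested so ob.
have [fin _ _ _] := sub_of_subtxn Ts.
apply: bigcup_finite => // -[b|s'] so.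
  by apply: sub_finite_set (finite_set1 b) => b' /basic_opsP ->.
by apply: IH => //; apply: sub_of_nested so.
Qed.

(** The four combinations of basic and nested elements match the four rules of [proj_sub_lt] that
    compare two elements of one body. *)
Lemma in_elem_lt s o1 o2 p q : in_elem s o1 p -> in_elem s o2 q ->
  prec (body s) o1 o2 -> proj_sub_lt s p q.
Proof.
move=> [so1 [b1 o1b1 <-]] [so2 [b2 o2b2 <-]].
case: o1 o2 so1 so2 o1b1 o2b2 => [c1|s1] [c2|s2] so1 so2 o1b1 o2b2 lt12.
- move/basic_opsP: o1b1 so1 lt12 => ->; move/basic_opsP: o2b2 so2 => ->.
  by move=> sb2 sb1; apply: psl_basic_basic.
- move/basic_opsP: o1b1 so1 lt12 => -> so1 lt12.
  by apply: psl_basic_nested lt12 _ => //; exists b2.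
- move/basic_opsP: o2b2 so2 lt12 => -> so2 lt12.
  by apply: psl_nested_basic lt12 _ => //; exists b1.
- by apply: psl_nested_nested lt12 _ _ => //; [exists b1|exists b2].
Qed.

Lemma proj_basic_readP b n : txn_basic_ops T b ->
  proj_basic b = CRead i n -> exists j, b = Read (ST i j n.1) n.2.
Proof. by case: b => -[i0 j k] x _ //= [-> <-]; exists j. Qed.

Lemma proj_basic_writeP b n : txn_basic_ops T b ->
  proj_basic b = CWrite i n -> exists j, b = Write (ST i j n.1) n.2.
Proof. by case: b => -[i0 j k] x _ //= [-> <-]; exists j. Qed.

(** The induction descends to the innermost sub-transaction containing both operations. There they
    lie in distinct elements, which the read-write condition of [is_subtxn] orders. *)
Lemma proj_sub_read_write s n : sub_of T s ->
  proj_sub_ops s (CRead i n) -> proj_sub_ops s (CWrite i n) ->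
  proj_sub_lt s (CRead i n) (CWrite i n) \/
  proj_sub_lt s (CWrite i n) (CRead i n).
Proof.
move=> Ts; have acc := sub_of_acc Ts; elim: acc Ts => {}s _ IH Ts.
move=> /in_elemP[o1 e1] /in_elemP[o2 e2].
have [e|ne] := pselect (o1 = o2).
  (* The common element must be nested: a single basic operation cannot project to both a read and a
     write. *)
  subst o2; case: e1 e2 => so1 [b1 ob1 pb1] [_ [b2 ob2 pb2]].
  case: o1 so1 ob1 ob2 => [b|s'] so1 ob1 ob2.
    move/basic_opsP: ob1 pb1 => <-; move/basic_opsP: ob2 pb2 => <-.
    by move=> ->.
  have rs' : proj_sub_ops s' (CRead i n) by exists b1.
  have ws' : proj_sub_ops s' (CWrite i n) by exists b2.
  by case: (IH s' so1 (sub_of_nested Ts so1) rs' ws') => lt; [left|right];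
    apply: psl_inner lt.
have Tb o b : carrier (body s) o -> basic_ops o b -> txn_basic_ops T b.
  by move=> so ob; apply: sub_of_basic_ops Ts _; apply: basic_ops_nested so ob.
have [_ _ _] := sub_of_subtxn Ts.
case: s {IH} Ts e1 e2 Tb => i0 j0 k0 Ts e1 e2 Tb rw.
have /= ei := sub_of_index Ts; subst i0.
case: (e1) (e2) => so1 [b1 ob1 pb1] [so2 [b2 ob2 pb2]].
have [j1 eb1] := proj_basic_readP (Tb _ _ so1 ob1) pb1.
have [j2 eb2] := proj_basic_writeP (Tb _ _ so2 ob2) pb2.
subst b1 b2.
by case: (rw _ _ _ _ _ _ so1 so2 ne ob1 ob2) => lt; [left|right];
  apply: in_elem_lt lt.
Qed.

(** * Projected transactions *)

Lemma proj_txn_opsP p :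
  proj_txn_ops body i T p <-> exists2 a, carrier T a & projects a p.
Proof.
have [_ idx _ _ _] := txnT.
split=> [[[s Ts sp]|[-> Tc]|[-> Ta]]|[[s|c|c] Ta]] /=.
- by exists (Sub s).
- by exists (RCommit i).
- by exists (RAbort i).
- by move=> sp; constructor 1; exists s.
- by have /= e := idx _ Ta; subst c => ->; constructor 2.
- by have /= e := idx _ Ta; subst c => ->; constructor 3.
Qed.

Lemma projects_index a p : carrier T a -> projects a p -> classic_index p = i.
Proof.
have [_ idx _ _ _] := txnT.
case: a => [s|c|c] Ta /=; [|by have /= -> := idx _ Ta => ->..].
case=> b sb <-; have Tb := sub_of_basic_ops (sub_of_top _ Ta) sb.
by have := txn_basic_ops_index Tb; case: b {sb Tb} => -[].
Qed.

Lemma txn_projects_inj : projects_inj T.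
Proof.
have acc s p : projects (Sub s) p -> forall j, p <> CCommit j /\ p <> CAbort j.
  by move=> /proj_sub_ops_access[] [j' [x ->]].
case=> [s|c|c] [s'|c'|c'] p Ta Tb.
- by move=> sp s'p; congr Sub; apply: proj_sub_ops_inj Ta Tb sp s'p.
- by move=> /acc/(_ c')[].
- by move=> /acc/(_ c')[].
- by move=> /[swap] /acc/(_ c)[].
- by move=> -> [->].
- by move=> ->.
- by move=> /[swap] /acc/(_ c)[].
- by move=> ->.
- by move=> -> [->].
Qed.

Lemma txn_poset : is_poset T.
Proof. by case: txnT => -[]. Qed.

(** Transitive closure creates no inequality beyond those inherited from [T] or from one of its
    sub-transactions. *)
Lemma proj_txn_lt_lifts p q : proj_txn_lt body i T p q -> lifts_to T p q.
Proof.
elim=> {p q}.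
- move=> s p q Ts ltpq; exists (Sub s), (Sub s).
  have [sp sq] := proj_sub_lt_ops ltpq.
  by split => //; right; exists s.
- move=> s s' p q Ts Ts' ss' sp s'q; exists (Sub s), (Sub s').
  by split=> //; left.
- move=> t p et /proj_txn_opsP[b Tb bt] /proj_txn_opsP[a Ta ap] npt.
  exists a, b; split => //; left.
  have [_ idx _ last _] := txnT.
  (* Sub-transactions project to reads and writes only, so [b] is the final commit or abort, which
     follows everything else in [T]. *)
  have eb : b = RCommit i \/ b = RAbort i.
    case: b Tb bt => [s|c|c] Tb.
    - by move=> /proj_sub_ops_access[] [j [x e]]; case: et; rewrite e.
    - by have /= -> := idx _ Tb; left.
    - by have /= -> := idx _ Tb; right.
  apply: last => // eab; subst b; apply: npt.
  by case: eb => ea; subst a; rewrite ap bt.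
- move=> p q r _ lpq _ lqr.
  exact: lifts_to_trans txn_poset txn_projects_inj lpq lqr.
Qed.

Lemma txn_read_write s1 s2 n : carrier T (Sub s1) -> carrier T (Sub s2) ->
  s1 <> s2 -> proj_sub_ops s1 (CRead i n) -> proj_sub_ops s2 (CWrite i n) ->
  prec T (Sub s1) (Sub s2) \/ prec T (Sub s2) (Sub s1).
Proof.
move=> Ts1 Ts2 ns [b1 sb1 eb1] [b2 sb2 eb2].
have Tb1 := sub_of_basic_ops (sub_of_top _ Ts1) sb1.
have Tb2 := sub_of_basic_ops (sub_of_top _ Ts2) sb2.
have [j1 e1] := proj_basic_readP Tb1 eb1; subst b1.
have [j2 e2] := proj_basic_writeP Tb2 eb2; subst b2.
by have [_ _ _ _ rw] := txnT; apply: rw sb1 sb2.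
Qed.

Lemma proj_txn_commit :
  proj_txn_ops body i T (CCommit i) <-> carrier T (RCommit i).
Proof.
split=> [|Tc]; last by constructor 2.
by case=> [[s Ts /proj_sub_ops_access[] [? [? //]]]|[]//|[]//].
Qed.

Lemma proj_txn_abort :
  proj_txn_ops body i T (CAbort i) <-> carrier T (RAbort i).
Proof.
split=> [|Ta]; last by constructor 3.
by case=> [[s Ts /proj_sub_ops_access[] [? [? //]]]|[]//|[]//].
Qed.

Lemma proj_txn_classic : is_classic_txn i (proj_txn body i T).
Proof.
have [[finT _ _] _ ab last _] := txnT.
split.
- split.
    apply: (@sub_finite_set _ _
      (\bigcup_(a in carrier T) [set p | projects a p])).
      by move=> p /proj_txn_opsP[a Ta ap]; exists a.
    apply: bigcup_finite => // -[s|c|c] Ta.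
    + exact: finite_image (finite_basic_ops (sub_of_top _ Ta)).
    + exact: finite_set1.
    + exact: finite_set1.
  split=> /= [p q /proj_txn_lt_lifts[a [b [[Ta ap] [Tb bq] _]]]|p|p q r].
  + by split; apply/proj_txn_opsP; [exists a|exists b].
  (* A loop would lift to a loop in [T] or inside one top-level sub-transaction. *)
  + move=> /proj_txn_lt_lifts; apply: lifts_to_irr txn_poset txn_projects_inj _.
    by move=> s Ts; apply: proj_sub_lt_irr (sub_of_top _ Ts).
  + exact: ptl_trans.
- by move=> p /proj_txn_opsP[a Ta ap]; apply: projects_index Ta ap.
- by rewrite /= proj_txn_commit proj_txn_abort.
- by move=> t et Tt p Tp npt; apply: ptl_end.
- move=> n /proj_txn_opsP[a Ta ar] /proj_txn_opsP[b Tb bw].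
  case: a b Ta Tb ar bw => [s|//|//] [s'|//|//] Ts Ts' /= sr s'w.
  (* A common top-level sub-transaction orders the two operations itself; otherwise [T] orders the
     two sub-transactions. *)
  have [e|ns] := pselect (s = s').
    subst s'; case: (proj_sub_read_write (sub_of_top _ Ts) sr s'w) => lt;
    by [left; apply: ptl_inner lt|right; apply: ptl_inner lt].
  case: (txn_read_write Ts Ts' ns sr s'w) => lt; [left|right];
  by apply: ptl_sub_sub lt _ _.
Qed.

(** A reactor transaction is only required to order read-write pairs. This suffices because two
    distinct top-level sub-transactions cannot both write the same item. *)
Lemma reactor_txn_conflict a a' : carrier T a -> carrier T a' -> a <> a' ->
  reactor_conflict body a a' -> prec T a a' \/ prec T a' a.
Proof.
case: a a' => [s1|//|//] [s2|//|//] Ts1 Ts2 ns.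
move=> /reactor_conflictP[p [q [sp sq pq]]].
have {}ns : s1 <> s2 by move=> e; apply: ns; rewrite e.
have npq : p <> q.
  by move=> e; subst q; apply: ns; apply: proj_sub_ops_inj Ts1 Ts2 sp sq.
have ep := @projects_index (Sub _) _ Ts1 sp.
have eq := @projects_index (Sub _) _ Ts2 sq.
have [x [] [? ?]] := classic_conflict_same_index ep eq npq pq; subst p q.
  exact: txn_read_write sp sq.
by case: (txn_read_write Ts2 Ts1 (nesym ns) sq sp); [right|left].
Qed.

End Transaction.
(** * Projected histories *)

Local Notation reactorM := (reactor_model items body).

Lemma reactor_regular : @regular reactorM txn_op_index.
Proof.
split=> /=.
- move=> [s1|//|//] [s2|//|//] [k [x [w ref1 ref2]]]; exists k, x; split=> //.
  by case: w; [right|left].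
- by move=> i T; apply: txn_poset.
- move=> i T a txnT Ta; have [_ /(_ _ Ta) + _ _ _] := txnT.
  by case: a Ta => [[i' j k]|c|c].
- by move=> i T a b txnT; apply: (reactor_txn_conflict txnT).
- by move=> i T [].
Qed.

Section History.
Variable H : history reactorM.
Hypothesis histH : is_history H.

Lemma history_txn i : h_ids H i -> is_reactor_txn i (h_txn H i).
Proof. by case: histH => -[_ h] _ _ _ _; apply: h. Qed.

Lemma history_txn_carrier i a :
  h_ids H i -> carrier (h_txn H i) a -> carrier (h_po H) a.
Proof. by case: histH => _ _ -> _ _ idi Ta; exists i. Qed.

(** The index of a classic operation identifies its transaction, inside which injectivity is
    known. *)
Lemma history_projects_inj : projects_inj (h_po H).
Proof.
have [_ _ carH _ _] := histH.
move=> a b p; rewrite carH => -[i idi Ta] [j idj Tb] ap bp.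
have ei := projects_index (history_txn idi) Ta ap.
have := projects_index (history_txn idj) Tb bp; rewrite ei => e; subst j.
exact: (txn_projects_inj (history_txn idi)) Ta Tb ap bp.
Qed.

(** The order of [H] contains the orders of its transactions and every inequality that the conflict
    rule projects, so both rules lift. *)
Lemma proj_history_lt_lifts p q :
  proj_history_lt H p q -> lifts_to (h_po H) p q.
Proof.
have [_ poH _ incl _] := histH.
elim=> {p q} [i p q idi|i i' s s' p q idi idi' Ts Ts' ss' sp s'q _|p q r _ + _].
- move=> /(proj_txn_lt_lifts (history_txn idi)); apply: lifts_to_sub.
    by move=> a; apply: history_txn_carrier.
  exact: incl.
- exists (Sub s), (Sub s'); split; [split|split|by left] => //.
    exact: history_txn_carrier idi Ts.
  exact: history_txn_carrier idi' Ts'.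
- exact: lifts_to_trans poH history_projects_inj.
Qed.

Lemma proj_history_is_history : is_history (proj_history H).
Proof.
have [[fin _] poH carH incl conf] := histH.
split => //=.
- by split => // i /history_txn; apply: proj_txn_classic.
- split=> /= [p q /proj_history_lt_lifts[a [b [[+ ap] [+ bq] _]]]|p|p q r].
  + rewrite carH => -[i idi Ta] [j idj Tb].
    split; [exists i|exists j] => //=; apply/proj_txn_opsP;
      by [apply: history_txn|exists a|exists b].
  + move=> /proj_history_lt_lifts.
    apply: lifts_to_irr poH history_projects_inj _ => s.
    rewrite carH => -[i idi Ts].
    exact: (proj_sub_lt_irr (history_txn idi) (sub_of_top _ Ts)).
  + exact: phl_trans.
- by move=> i idi p q; apply: phl_inner.
- move=> p q [i idi ip] [j idj jq] npq pq.
  have /(proj_txn_opsP (history_txn idi))[a Ta ap] := ip.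
  have /(proj_txn_opsP (history_txn idj))[b Tb bq] := jq.
  (* Within one transaction, the projected transaction orders the pair. Across transactions, the
     conflict passes to the two enclosing sub-transactions, whose order in [H] projects back. *)
  have [e|nij] := pselect (i = j).
    subst j; have txni := proj_txn_classic (history_txn idi).
    case: (regular_conflict (classic_regular _) txni ip jq npq pq) => lt;
    by [left; apply: phl_inner lt|right; apply: phl_inner lt].
  have [w [n [pn qn]]] := pq.
  case: a Ta ap => [s|c|c] Ts sp; [|by rewrite sp in pn..].
  case: b Tb bq => [s'|c|c] Ts' s'q; [|by rewrite s'q in qn..].
  have ns : Sub s <> Sub s'.
    move=> [e]; subst s'; apply: nij.
    rewrite -(projects_index (history_txn idi) Ts sp).
    exact: (projects_index (history_txn idj) Ts' sp).
  have qp := regular_conflictC (classic_regular _) pq.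
  case: (conf (Sub s) (Sub s')) => //.
  + exact: history_txn_carrier idi Ts.
  + exact: history_txn_carrier idj Ts'.
  + by apply/reactor_conflictP; exists p, q.
  + by move=> lt; left; apply: phl_conflict idi idj Ts Ts' lt sp s'q pq.
  + by move=> lt; right; apply: phl_conflict idj idi Ts' Ts lt s'q sp qp.
Qed.

Lemma proj_history_committed i : committed (proj_history H) i <-> committed H i.
Proof.
split=> -[idi ci]; split => //.
  exact: (proj1 (proj_txn_commit i _) ci).
exact: (proj2 (proj_txn_commit i _) ci).
Qed.

(** The projected order is transitively closed, so an edge of the projection need not come from a
    single use of the conflict rule; lifting traces it back to [H] all the same. *)
Lemma proj_history_conflict_edge i j : h_ids H i -> h_ids H j -> i <> j ->
  conflict_edge (proj_history H) i j <-> conflict_edge H i j.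
Proof.
move=> idi idj nij; split=> [[p [q [ip jq pq ltpq]]]|[a [b [Ta Tb ab ltab]]]].
  have /(proj_txn_opsP (history_txn idi))[a Ta ap] := ip.
  have /(proj_txn_opsP (history_txn idj))[b Tb bq] := jq.
  have [a' [b' [[Ha' a'p] [Hb' b'q] ltab]]] := proj_history_lt_lifts ltpq.
  have Ha := history_txn_carrier idi Ta; have Hb := history_txn_carrier idj Tb.
  have e := history_projects_inj Ha' Ha a'p ap; subst a'.
  have e := history_projects_inj Hb' Hb b'q bq; subst b'.
  exists a, b; split => //.
    have [w [n [pn qn]]] := pq.
    case: a ap {Ta a'p Ha Ha' ltab} => [s|c|c] ap; [|by rewrite ap in pn..].
    case: b bq {Tb b'q Hb Hb'} => [s'|c|c] bq; [|by rewrite bq in qn..].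
    by apply/reactor_conflictP; exists p, q.
  (* A single sub-transaction containing both operations would force [i = j]. *)
  case: ltab => // -[s [ea eb _]]; case: nij; subst a b.
  rewrite -(projects_index (history_txn idi) Ta ap).
  exact: (projects_index (history_txn idj) Tb ap).
case: a b Ta Tb ab ltab => [s|//|//] [s'|//|//] Ts Ts'.
move=> /reactor_conflictP[p [q [sp s'q pq]]] ltss'.
exists p, q; split => //.
- by apply/(proj_txn_opsP (history_txn idi)); exists (Sub s).
- by apply/(proj_txn_opsP (history_txn idj)); exists (Sub s').
- exact: phl_conflict idi idj Ts Ts' ltss' sp s'q pq.
Qed.

(** Committed transactions and conflict edges agree, so the same [lt] serves both histories. *)
Lemma proj_history_serialization_order lt :
  serialization_order (proj_history H) lt <-> serialization_order H lt.
Proof.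
have cE : committed (proj_history H) = committed H.
  by apply/seteqP; split=> i /proj_history_committed.
rewrite /serialization_order cE.
by split=> -[irr tr tot edge]; split => // i j ci cj nij
  /(proj_history_conflict_edge (proj1 ci) (proj1 cj) nij); apply: edge.
Qed.

End History.
End Reactor.

Theorem theorem2p7 (X : Type) (items : nat -> set X)
    (body : stid -> poset (sub_op X))
    (H : history (reactor_model items body)) :
  is_history H -> (serializable H <-> serializable (proj_history H)).
Proof.
move=> histH.
rewrite (serializableP (reactor_regular _ _) histH).
rewrite (serializableP (classic_regular _) (proj_history_is_history histH)).
by split=> -[lt ltH]; exists lt; apply/(proj_history_serialization_order histH).
Qed.
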